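(* Let $(M,g,I,J,K)$ be an HKT manifold. If $X$ is a special homothety of type $(a,b)$ on $M$ with $a,b\neq0$, then $X,IX,JX,KX$ generate a local action of $\mathbb H^*$ (the multiplicative group of non-zero quaternions).
   Context: HKT manifold: a $4m$-manifold $M$ with integrable complex structures $I,J,K$ satisfying the quaternion identities ($I^2=J^2=K^2=-1$, $IJ=K=-JI$), a pseudo-Riemannian metric $g$ of signature $(4p,4q)$ Hermitian with respect to $I,J,K$, and a (unique) connection $\nabla$ with $\nabla g=0$, $\nabla I=\nabla J=\nabla K=0$ whose torsion $T(Y,Z)=\nabla_YZ-\nabla_ZY-[Y,Z]$ is totally skew, i.e. $c(W,Y,Z)=g(W,T(Y,Z))$ is a 3-form. Special homothety of type $(a,b)$, $a,b\in\mathbb R$ constants: a vector field $X$ with $L_Xg=ag$; $L_{IX}g=L_{JX}g=L_{KX}g=0$; $L_{IX}I=L_{JX}J=L_{KX}K=0$; and $L_{IX}J=bK$, $L_{JX}K=bI$, $L_{KX}I=bJ$. ''Generate a local action of $\mathbb H^*$'' means an infinitesimal action: the real span of the vector fields $X,IX,JX,KX$ is closed under the Lie bracket and is a Lie algebra isomorphic to that of $\mathbb H^*$ (namely $\mathbb R\oplus\mathfrak{sp}(1)$). *)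

(* Defs.v *)
From HB Require Import structures.
From mathcomp Require Import all_boot all_order all_algebra.
From mathcomp Require Import all_classical all_reals topology normedtype derive.

Set Implicit Arguments.
Unset Strict Implicit.
Unset Printing Implicit Defensive.

Import Order.TTheory GRing.Theory Num.Theory.
Import numFieldNormedType.Exports.

Local Open Scope classical_set_scope.
Local Open Scope ring_scope.

Section Ck.
Variables (R : realType) (n : nat).
Implicit Types (U : set 'rV[R]_n) (f g : 'rV[R]_n -> R).

Fixpoint Ck (k : nat) U f : Prop :=
  {in U, continuous f} /\
  if k is k'.+1 then
    forall i : 'I_n,
      {in U, forall x, derivable f x (delta_mx 0 i)} /\
      Ck k' U ('D_(delta_mx 0 i) f)
  else True.

Definition smooth_on U f := forall k, Ck k U f.

Lemma Ck_continuous k U f : Ck k U f -> {in U, continuous f}.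
Proof. by case: k => [|k] []. Qed.

Lemma CkW k U f : Ck k.+1 U f -> Ck k U f.
Proof.
elim: k f => [|k IH] f [cf df]; first by split.
split=> // i; have [di /IH Di] := df i; by split.
Qed.

Lemma near_in U f g x : open U -> x \in U -> {in U, f =1 g} ->
  \forall y \near x, f y = g y.
Proof.
move=> oU /set_mem xU fg; near=> y; apply: fg; apply/mem_set.
by near: y; exact: open_nbhs_nbhs.
Unshelve. all: by end_near. Qed.

Lemma eq_Ck k U f g : open U -> {in U, f =1 g} -> Ck k U f -> Ck k U g.
Proof.
move=> oU; elim: k f g => [|k IH] f g fg [cf df].
all: have nfg x : x \in U -> \forall y \near x, f y = g y
  by move=> xU; exact: near_in xU fg.
all: have cg : {in U, continuous g}
  by move=> x xU; have /near_eq_cvg fgx := nfg x xU;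
     rewrite /continuous_at -fg//; exact: cvg_trans fgx (cf x xU).
- by split.
- split=> // i; have [di Di] := df i; split.
  + by move=> x xU; apply: near_eq_derivable (di x xU); exact: nfg.
  + apply: IH Di => x xU; apply: near_eq_derive; exact: nfg.
Qed.

Lemma Ck_cst k U (c : R) : open U -> Ck k U (cst c).
Proof.
move=> oU; elim: k c => [|k IH] c.
  by split=> // x _; exact: cst_continuous.
split=> [x _|i]; first exact: cst_continuous.
split=> [x _|]; first exact: derivable_cst.
by apply: eq_Ck (IH 0) => // x _; rewrite derive_cst.
Qed.

Lemma CkD k U f g : open U -> Ck k U f -> Ck k U g -> Ck k U (f + g).
Proof.
move=> oU; elim: k f g => [|k IH] f g [cf df] [cg dg].
  by split=> // x xU; apply: continuousD; [exact: cf|exact: cg].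
split=> [x xU|i]; first by apply: continuousD; [exact: cf|exact: cg].
have [di Di] := df i; have [ei Ei] := dg i; split=> [x xU|].
  by apply: derivableD; [exact: di|exact: ei].
apply: eq_Ck (IH _ _ Di Ei) => // x xU.
by rewrite deriveD; [|exact: di|exact: ei].
Qed.

Lemma CkM k U f g : open U -> Ck k U f -> Ck k U g -> Ck k U (f * g).
Proof.
move=> oU; elim: k f g => [|k IH] f g Cf Cg.
  case: Cf Cg => cf _ [cg _].
  by split=> // x xU; apply: continuousM; [exact: cf|exact: cg].
have [/CkW Cf' /CkW Cg'] := (Cf, Cg).
case: Cf Cg => cf df [cg dg].
split=> [x xU|i]; first by apply: continuousM; [exact: cf|exact: cg].
have [di Di] := df i; have [ei Ei] := dg i; split=> [x xU|].
  by apply: derivableM; [exact: di|exact: ei].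
apply: eq_Ck (CkD oU (IH _ _ Cf' Ei) (IH _ _ Cg' Di)) => // x xU.
by rewrite deriveM; [|exact: di|exact: ei].
Qed.

End Ck.

Record chart (R : realType) (n : nat) (M : topologicalType) := Chart {
  chart_dom : set M ;
  chart_cod : set 'rV[R]_n ;
  chart_map : M -> 'rV[R]_n ;
  chart_inv : 'rV[R]_n -> M ;
  chart_dom_open : open chart_dom ;
  chart_cod_open : open chart_cod ;
  chart_mapP : {homo chart_map : x / chart_dom x >-> chart_cod x} ;
  chart_invP : {homo chart_inv : u / chart_cod u >-> chart_dom u} ;
  chart_mapK : {in chart_dom, cancel chart_map chart_inv} ;
  chart_invK : {in chart_cod, cancel chart_inv chart_map} ;
  chart_map_continuous : {in chart_dom, continuous chart_map} ;
  chart_inv_continuous : {in chart_cod, continuous chart_inv} }.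

(* The atlas need not be maximal; manifolds are nonempty, not necessarily
   connected. *)
Record manifold (R : realType) (n : nat) := Manifold {
  mspace :> topologicalType ;
  atlas : set (chart R n mspace) ;
  manifold_nonempty : [set: mspace] !=set0 ;
  manifold_hausdorff : hausdorff_space mspace ;
  manifold_second_countable : @second_countable mspace ;
  atlas_cover : forall x, exists2 c, atlas c & chart_dom c x ;
  atlas_compat : forall c d, atlas c -> atlas d -> forall i : 'I_n,
    smooth_on (chart_cod c `&` chart_inv c @^-1` chart_dom d)
              (fun u => chart_map d (chart_inv c u) 0 i) }.

Section SmoothFunctions.
Variables (R : realType) (n : nat) (M : manifold R n).

Definition smooth : {pred M -> R} := fun f =>
  `[< forall c, atlas c -> smooth_on (chart_cod c) (f \o chart_inv c) >].

Record Cinf := MkCinf { Cinf_val :> M -> R ; CinfP : Cinf_val \in smooth }.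

HB.instance Definition _ := [isSub for Cinf_val].
HB.instance Definition _ := [Choice of Cinf by <:].

Lemma smooth_cst (c : R) : (cst c : M -> R) \in smooth.
Proof. by apply/asboolP => d _ k; apply: Ck_cst; exact: chart_cod_open. Qed.

Lemma smoothD (f g : M -> R) :
  f \in smooth -> g \in smooth -> f + g \in smooth.
Proof.
move=> /asboolP sf /asboolP sg; apply/asboolP => c Ac k.
by apply: (CkD _ (sf c Ac k) (sg c Ac k)); exact: chart_cod_open.
Qed.

Lemma smoothM (f g : M -> R) :
  f \in smooth -> g \in smooth -> f * g \in smooth.
Proof.
move=> /asboolP sf /asboolP sg; apply/asboolP => c Ac k.
by apply: (CkM _ (sf c Ac k) (sg c Ac k)); exact: chart_cod_open.
Qed.

Lemma smoothZ (a : R) (f : M -> R) : f \in smooth -> a *: f \in smooth.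
Proof. by move=> sf; exact: (smoothM (smooth_cst a) sf). Qed.

Lemma smooth_subring : subring_closed smooth.
Proof.
split=> [|f g sf sg|f g sf sg]; first exact: (smooth_cst 1).
- by apply: smoothD => //; rewrite -scaleN1r; exact: smoothZ.
- exact: smoothM.
Qed.

Lemma smooth_submod : subsemimod_closed smooth.
Proof.
split=> [|a f sf]; last exact: smoothZ.
by split; [exact: (smooth_cst 0)|exact: smoothD].
Qed.

HB.instance Definition _ :=
  GRing.SubChoice_isSubComPzRing.Build (M -> R) smooth Cinf smooth_subring.
HB.instance Definition _ :=
  GRing.SubZmodule_isSubLmodule.Build R (M -> R) smooth Cinf smooth_submod.

End SmoothFunctions.

Section VectorFields.
Variables (R : realType) (n : nat) (M : manifold R n).
Local Notation C := (Cinf M).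

(* Vector fields are the derivations of the R-algebra C of smooth functions. *)
Definition is_derivation (X : C -> C) : Prop :=
  (forall (a : R) (f g : C), X (a *: f + g) = a *: X f + X g) /\
  (forall f g : C, X (f * g) = X f * g + f * X g).

(* C^o is C seen as a C-module; this makes C -> C^o a C-module as well. *)
Definition derivation : {pred C -> C^o} := fun X => `[< is_derivation X >].

Record vfield := MkVfield {
  vfield_val :> C -> C^o ; vfieldP : vfield_val \in derivation }.

HB.instance Definition _ := [isSub for vfield_val].
HB.instance Definition _ := [Choice of vfield by <:].

Definition cstC (a : R) : C := a *: (1 : C).

Lemma rscaleE (a : R) (f : C) : a *: f = cstC a * f.
Proof.
apply/val_inj/funext => x /=; change (a * f x = (a * 1) * f x).
by rewrite mulr1.
Qed.

Lemma derivation_submod : subsemimod_closed derivation.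
Proof.
split=> [|f X /asboolP[lX dX]].
  split=> [|X Y /asboolP[lX dX] /asboolP[lY dY]]; apply/asboolP; split.
  - by move=> a f g; rewrite /= scaler0 addr0.
  - by move=> f g; rewrite /= mul0r mulr0 addr0.
  - move=> a f g; change (X (a *: f + g) + Y (a *: f + g) =
      a *: (X f + Y f : C) + (X g + Y g)).
    by rewrite lX lY scalerDr addrACA.
  - move=> f g; change (X (f * g) + Y (f * g) =
      (X f + Y f) * g + f * (X g + Y g)).
    by rewrite dX dY mulrDl mulrDr addrACA.
apply/asboolP; split.
- move=> a h k; change (f * X (a *: h + k) = a *: (f * X h : C) + f * X k).
  by rewrite lX mulrDr !rscaleE mulrCA.
- move=> h k; change (f * X (h * k) = f * X h * k + h * (f * X k)).
  by rewrite dX mulrDr mulrA [h * (f * _)]mulrCA.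
Qed.

HB.instance Definition _ :=
  GRing.SubChoice_isSubLmodule.Build C (C -> C^o) derivation vfield
    derivation_submod.

Lemma is_derivation_vfield (X : vfield) : is_derivation X.
Proof. exact/asboolP/vfieldP. Qed.

Lemma cross_terms_cancel (V : zmodType) (a b c d e f : V) :
  a + b + (c + d) - (e + c + (b + f)) = a - e + (d - f).
Proof.
rewrite [a + b]addrC addrACA [e + c]addrC [c + e + _]addrACA [c + b]addrC.
by rewrite opprD [LHS]addrACA subrr add0r opprD [LHS]addrACA.
Qed.

Lemma is_derivation_comm (X Y : C -> C) :
  is_derivation X -> is_derivation Y ->
  is_derivation (fun f => X (Y f) - Y (X f)).
Proof.
move=> [lX dX] [lY dY].
have XD f g : X (f + g) = X f + X g by rewrite -[f]scale1r lX !scale1r.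
have YD f g : Y (f + g) = Y f + Y g by rewrite -[f]scale1r lY !scale1r.
split=> [a f g|f g]; first by rewrite lX lY lX lY scalerBr opprD addrACA.
rewrite dX dY XD YD !dX !dY mulrBl mulrBr.
exact: cross_terms_cancel.
Qed.

Lemma lie_subproof (X Y : vfield) :
  (fun f : C => X (Y f : C) - Y (X f : C) : C) \in derivation.
Proof.
by apply/asboolP; apply: is_derivation_comm; exact: is_derivation_vfield.
Qed.

Definition lie (X Y : vfield) : vfield := MkVfield (lie_subproof X Y).

End VectorFields.

Section Tensors.
Variables (R : realType) (n : nat) (M : manifold R n).
Local Notation C := (Cinf M).
Local Notation V := (vfield M).
Implicit Types (W X Y Z : V) (f : C) (T I J K : {linear V -> V}).
Implicit Types (g : V -> V -> C) (nabla : V -> V -> V).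

(* Tensor fields are C-multilinear maps on vector fields: T : {linear V -> V}
   is a field of endomorphisms of the tangent bundle. *)

Definition lie_endo X T Y : V := lie X (T Y) - T (lie X Y).

Definition lie_form X g Y Z : C := X (g Y Z) - g (lie X Y) Z - g Y (lie X Z).

(* The vectors E_i at x form an orthonormal basis of the tangent space at x:
   being n = dim M vectors with invertible Gram matrix, they are a basis. *)
Definition orthonormal_at r g (x : M) (E : 'I_n -> V) :=
  forall i j, g (E i) (E j) x =
    if i == j then (if (i < r)%N then 1 else -1) else 0.

(* The signature is (r, n - r): r positive and n - r negative directions. *)
Record pseudo_riemannian r g : Prop := PseudoRiemannian {
  metric_linear : forall f X Y Z, g (f *: X + Y) Z = f * g X Z + g Y Z ;
  metric_sym : forall X Y, g X Y = g Y X ;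
  metric_signature : forall x : M, exists E, orthonormal_at r g x E }.

Definition nijenhuis T X Y : V :=
  lie (T X) (T Y) - T (lie (T X) Y) - T (lie X (T Y)) - lie X Y.

Record complex_structure T : Prop := ComplexStructure {
  almost_complex : forall X, T (T X) = - X ;
  integrable : forall X Y, nijenhuis T X Y = 0 }.

Definition hermitian_metric g T := forall X Y, g (T X) (T Y) = g X Y.

(* nabla X Y is the covariant derivative of Y along X. *)
Record connection nabla : Prop := Connection {
  connection_linear : forall f X Y Z,
    nabla (f *: X + Y) Z = f *: nabla X Z + nabla Y Z ;
  connection_additive : forall X Y Z,
    nabla X (Y + Z) = nabla X Y + nabla X Z ;
  connection_leibniz : forall f X Y,
    nabla X (f *: Y) = (X f : C) *: Y + f *: nabla X Y }.

Definition torsion nabla Y Z : V := nabla Y Z - nabla Z Y - lie Y Z.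

Definition parallel_form nabla g :=
  forall X Y Z, (X (g Y Z) : C) = g (nabla X Y) Z + g Y (nabla X Z).

Definition parallel_endo nabla T := forall X Y, nabla X (T Y) = T (nabla X Y).

Record three_form (c : V -> V -> V -> C) : Prop := ThreeForm {
  three_form_linear : forall f X Y Z W,
    c (f *: X + Y) Z W = f * c X Z W + c Y Z W ;
  three_form_skew12 : forall X Y Z, c X Y Z = - c Y X Z ;
  three_form_skew23 : forall X Y Z, c X Y Z = - c X Z Y }.

Record HKT_connection g I J K nabla : Prop := HKTConnection {
  hkt_connection : connection nabla ;
  hkt_parallel_g : parallel_form nabla g ;
  hkt_parallel_I : parallel_endo nabla I ;
  hkt_parallel_J : parallel_endo nabla J ;
  hkt_parallel_K : parallel_endo nabla K ;
  hkt_torsion : three_form (fun W Y Z => g W (torsion nabla Y Z)) }.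

Record HKT p q g I J K : Prop := MkHKT {
  hkt_dim : n = (4 * p + 4 * q)%N ;
  hkt_metric : pseudo_riemannian (4 * p) g ;
  hkt_I : complex_structure I ;
  hkt_J : complex_structure J ;
  hkt_K : complex_structure K ;
  hkt_IJ : forall X, I (J X) = K X ;
  hkt_JI : forall X, J (I X) = - K X ;
  hkt_hermitian_I : hermitian_metric g I ;
  hkt_hermitian_J : hermitian_metric g J ;
  hkt_hermitian_K : hermitian_metric g K ;
  hkt_nabla : exists! nabla, HKT_connection g I J K nabla }.

Record special_homothety g I J K (a b : R) X : Prop := SpecialHomothety {
  homothety_X : forall Y Z, lie_form X g Y Z = a *: g Y Z ;
  killing_IX : forall Y Z, lie_form (I X) g Y Z = 0 ;
  killing_JX : forall Y Z, lie_form (J X) g Y Z = 0 ;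
  killing_KX : forall Y Z, lie_form (K X) g Y Z = 0 ;
  lie_IX_I : forall Y, lie_endo (I X) I Y = 0 ;
  lie_JX_J : forall Y, lie_endo (J X) J Y = 0 ;
  lie_KX_K : forall Y, lie_endo (K X) K Y = 0 ;
  lie_IX_J : forall Y, lie_endo (I X) J Y = cstC M b *: K Y ;
  lie_JX_K : forall Y, lie_endo (J X) K Y = cstC M b *: I Y ;
  lie_KX_I : forall Y, lie_endo (K X) I Y = cstC M b *: J Y }.

Definition real_span (s : seq V) : set V :=
  [set Y | exists t : 'I_(size s) -> R, Y = \sum_i cstC M (t i) *: s`_i].

End Tensors.

Section Quaternions.
Variable R : realType.

(* The row (u0, u1, u2, u3) stands for u0 + u1 i + u2 j + u3 k. *)
Local Notation quat := 'rV[R]_4.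

Definition quat_mul (u v : quat) : quat :=
  let a := u 0 0 in let b := u 0 1 in let c := u 0 2 in let d := u 0 3 in
  let a' := v 0 0 in let b' := v 0 1 in let c' := v 0 2 in let d' := v 0 3 in
  \row_i [:: a * a' - b * b' - c * c' - d * d' ;
             a * b' + b * a' + c * d' - d * c' ;
             a * c' - b * d' + c * a' + d * b' ;
             a * d' + b * c' - c * b' + d * a' ]`_i.

(* The Lie algebra of the group H^* of units of the quaternion algebra H is H
   with the commutator bracket; it is the direct sum of its centre R and of
   the imaginary quaternions sp(1). *)
Definition quat_lie (u v : quat) : quat := quat_mul u v - quat_mul v u.

End Quaternions.

Section InfinitesimalAction.
Variables (R : realType) (n : nat) (M : manifold R n).

Definition quat_lie_isom (phi : 'rV[R]_4 -> vfield M) (S : set (vfield M)) :=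
  [/\ forall (t : R) u v, phi (t *: u + v) = cstC M t *: phi u + phi v,
      forall u v, phi (quat_lie u v) = lie (phi u) (phi v),
      injective phi
    & range phi = S].

Definition generate_local_Hstar_action (s : seq (vfield M)) :=
  (forall Y Z, real_span s Y -> real_span s Z -> real_span s (lie Y Z)) /\
  exists phi, quat_lie_isom phi (real_span s).

End InfinitesimalAction.

(* Main.v *)
Require Import Defs.
From mathcomp Require Import all_boot all_order all_algebra.
From mathcomp Require Import all_classical all_reals.
From mathcomp Require Import ring lra.

(** Each condition L_(IX) I = L_(JX) J = L_(KX) K = 0, evaluated on X itself,
    says I [IX, X] = J [JX, X] = K [KX, X] = 0, so X commutes with IX, JX and
    KX.  Evaluating L_(IX) J = bK on X then gives
    [IX, JX] = J [IX, X] + b KX = b KX, and cyclically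
    ([lie_frame_central], [lie_frame_product]).  These are the relations of
    R + sp(1) up to the factor b: as [i, j] = 2k in the quaternions, the map
    1 |-> X, i |-> (2/b) IX, j |-> (2/b) JX, k |-> (2/b) KX is a morphism of
    Lie algebras with image the real span ([quaternionic_frame_action]).

    It remains to see that the four fields are linearly independent over R.
    If u0 X + u1 IX + u2 JX + u3 KX = 0, applying the conjugate quaternion
    gives (u0^2 + u1^2 + u2^2 + u3^2) X = 0 ([quaternion_span_free]), so it is
    enough that X != 0.  This is where a != 0 enters: if X = 0, then
    a g = L_X g = 0, whereas g has a vector of square 1 or -1 at any point of a
    nonempty manifold of positive dimension ([homothety_neq0]). *)

Import GRing.Theory Num.Theory.
Local Open Scope ring_scope.
Local Open Scope classical_set_scope.

(** * Real Lie algebra of vector fields *)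

Section VectorFieldCalculus.
Context {R : realType} {n : nat} {M : manifold R n}.
Implicit Types (Y Z : vfield M) (f h : Cinf M) (c : R).

Lemma Cinf_ext f h : (forall x, f x = h x) -> f = h.
Proof. by move=> fh; apply/val_inj/funext. Qed.

Lemma cstCE c x : cstC M c x = c.
Proof. exact: mulr1. Qed.

Definition real_functional (ev : vfield M -> R) :=
  [/\ forall Y Z, ev (Y + Z) = ev Y + ev Z,
      forall Y, ev (- Y) = - ev Y,
      ev 0 = 0
    & forall c Y, ev (cstC M c *: Y) = c * ev Y].

(** The functionals that separate vector fields are Y |-> (Y f) (x), for f a
    smooth function and x a point.  Through them, identities between real
    combinations of vector fields and of their brackets become identities
    between real numbers. *)
Lemma vfield_ext Y Z :
  (forall ev, real_functional ev -> ev Y = ev Z) -> Y = Z.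
Proof.
move=> YZ; apply/val_inj/funext => f; apply: Cinf_ext => x.
apply: (YZ (fun W => (W f : Cinf M) x)); split=> // c W.
change (cstC M c x * (W f : Cinf M) x = c * (W f : Cinf M) x).
by rewrite cstCE.
Qed.

Lemma lieN Y Z : lie Y Z = - lie Z Y.
Proof. by apply/val_inj/funext => f; rewrite /= -opprB. Qed.

Lemma lieYY Y : lie Y Y = 0.
Proof. by apply/val_inj/funext => f; rewrite /= subrr. Qed.

Lemma lie_linearl c Y1 Y2 Z :
  lie (cstC M c *: Y1 + Y2) Z = cstC M c *: lie Y1 Z + lie Y2 Z.
Proof.
have [lZ _] := is_derivation_vfield Z.
apply/val_inj/funext => f.
change ((cstC M c * Y1 (Z f) + Y2 (Z f)) - Z (cstC M c * Y1 f + Y2 f) =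
  cstC M c * (Y1 (Z f) - Z (Y1 f)) + (Y2 (Z f) - Z (Y2 f)) :> Cinf M).
by rewrite -!rscaleE lZ scalerBr opprD addrACA.
Qed.

Lemma lie_linearr c Y Z1 Z2 :
  lie Y (cstC M c *: Z1 + Z2) = cstC M c *: lie Y Z1 + lie Y Z2.
Proof. by rewrite lieN lie_linearl opprD -scalerN -!lieN. Qed.

Lemma lie0l Z : lie 0 Z = 0.
Proof.
rewrite [in LHS](_ : 0 = cstC M (-1) *: 0 + 0) ?lie_linearl; last first.
  by rewrite scaler0 addr0.
by apply: vfield_ext => ev [evD evN ev0 evZ]; rewrite evD evZ ev0 mulN1r addNr.
Qed.

Lemma lieZl c Y Z : lie (cstC M c *: Y) Z = cstC M c *: lie Y Z.
Proof. by rewrite -[_ *: Y]addr0 lie_linearl lie0l addr0. Qed.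

Lemma lieZr c Y Z : lie Y (cstC M c *: Z) = cstC M c *: lie Y Z.
Proof. by rewrite lieN lieZl -scalerN -lieN. Qed.

Lemma cstC_scale_eq0 c Y : c != 0 -> cstC M c *: Y = 0 -> Y = 0.
Proof.
move=> c0 cY; apply: vfield_ext => ev [evD evN ev0 evZ]; apply: (mulfI c0).
by rewrite -evZ cY ev0 mulr0.
Qed.

End VectorFieldCalculus.

(** * Four fields with the brackets of the quaternions *)

Section QuaternionicFrame.
Context {R : realType} {n : nat} {M : manifold R n}.
Implicit Types (u v : 'rV[R]_4).

Definition real_comb (e0 e1 e2 e3 : vfield M) (t0 t1 t2 t3 : R) : vfield M :=
  cstC M t0 *: e0 + (cstC M t1 *: e1 + (cstC M t2 *: e2 + cstC M t3 *: e3)).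

Lemma linear_real_comb (T : {linear vfield M -> vfield M}) e0 e1 e2 e3
    t0 t1 t2 t3 :
  T (real_comb e0 e1 e2 e3 t0 t1 t2 t3) =
  real_comb (T e0) (T e1) (T e2) (T e3) t0 t1 t2 t3.
Proof. by unfold real_comb; rewrite 3!linearD 4!linearZ. Qed.

Lemma real_spanP (e0 e1 e2 e3 Y : vfield M) :
  real_span [:: e0; e1; e2; e3] Y <->
  exists t0 t1 t2 t3, Y = real_comb e0 e1 e2 e3 t0 t1 t2 t3.
Proof.
split=> [[t ->]|[t0 [t1 [t2 [t3 ->]]]]].
  exists (t ord0), (t (lift ord0 ord0)), (t (lift ord0 (lift ord0 ord0))),
    (t (lift ord0 (lift ord0 (lift ord0 ord0)))).
  by rewrite !big_ord_recl big_ord0 addr0.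
exists (fun i => [:: t0; t1; t2; t3]`_i).
by rewrite !big_ord_recl big_ord0 addr0.
Qed.

Lemma rV4_ext u v :
  u 0 0 = v 0 0 -> u 0 1 = v 0 1 -> u 0 2 = v 0 2 -> u 0 3 = v 0 3 -> u = v.
Proof.
move=> uv0 uv1 uv2 uv3; apply/rowP => -[[|[|[|[|i]]]] // lti].
- by rewrite (_ : Ordinal lti = 0) //; apply: val_inj.
- by rewrite (_ : Ordinal lti = 1) //; apply: val_inj.
- by rewrite (_ : Ordinal lti = 2) //; apply: val_inj.
- by rewrite (_ : Ordinal lti = 3) //; apply: val_inj.
Qed.

(** The isomorphism sends 1, i, j, k to e0, (2/b) e1, (2/b) e2, (2/b) e3: for
    the rescaled fields [e1, e2] = b e3 becomes the quaternion commutator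
    [i, j] = 2k.  The real span is then closed under the bracket because it is
    the image of a morphism. *)
Lemma quaternionic_frame_action (b : R) (e0 e1 e2 e3 : vfield M) :
  b != 0 ->
  lie e0 e1 = 0 -> lie e0 e2 = 0 -> lie e0 e3 = 0 ->
  lie e1 e2 = cstC M b *: e3 ->
  lie e2 e3 = cstC M b *: e1 ->
  lie e3 e1 = cstC M b *: e2 ->
  (forall t0 t1 t2 t3, real_comb e0 e1 e2 e3 t0 t1 t2 t3 = 0 ->
    [/\ t0 = 0, t1 = 0, t2 = 0 & t3 = 0]) ->
  generate_local_Hstar_action [:: e0; e1; e2; e3].
Proof.
move=> b0 e01 e02 e03 e12 e23 e31 free.
pose phi u := real_comb e0 e1 e2 e3
  (u 0 0) (2 / b * u 0 1) (2 / b * u 0 2) (2 / b * u 0 3).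
have phi_linear (t : R) u v : phi (t *: u + v) = cstC M t *: phi u + phi v.
  apply: vfield_ext => ev [evD evN ev0 evZ].
  by rewrite /phi /real_comb !(evD, evN, ev0, evZ) !mxE; ring.
have phi_lie u v : phi (quat_lie u v) = lie (phi u) (phi v).
  rewrite /phi; unfold real_comb.
  rewrite !lie_linearl !lieZl !lie_linearr !lieZr.
  rewrite (lieN e1 e0) (lieN e2 e0) (lieN e3 e0) (lieN e2 e1) (lieN e3 e2).
  rewrite (lieN e1 e3) !lieYY e01 e02 e03 e12 e23 e31.
  apply: vfield_ext => ev [evD evN ev0 evZ].
  by rewrite !(evD, evN, ev0, evZ) !mxE /=; field.
have phi_range : range phi = real_span [:: e0; e1; e2; e3].
  apply/seteqP; split=> [_ [u _ <-]|Y /real_spanP[t0 [t1 [t2 [t3 ->]]]]].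
    by apply/real_spanP; do 4!eexists.
  exists (\row_i [:: t0; b / 2 * t1; b / 2 * t2; b / 2 * t3]`_i) => //.
  have bK (t : R) : 2 / b * (b / 2 * t) = t by field.
  by rewrite /phi !mxE !bK.
split=> [Y Z|].
  by rewrite -phi_range => -[u _ <-] [v _ <-]; exists (quat_lie u v).
exists phi; split; [exact: phi_linear|exact: phi_lie| |exact: phi_range].
move=> u v phi_uv.
have [|d0 d1 d2 d3] := free (u 0 0 - v 0 0) (2 / b * (u 0 1 - v 0 1))
  (2 / b * (u 0 2 - v 0 2)) (2 / b * (u 0 3 - v 0 3)).
  transitivity (phi u - phi v); last by rewrite phi_uv subrr.
  apply: vfield_ext => ev [evD evN ev0 evZ].
  by rewrite /phi /real_comb !(evD, evN, ev0, evZ); ring.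
have cancel (s t : R) : 2 / b * (s - t) = 0 -> s = t.
  move=> /eqP; rewrite mulf_eq0 mulf_eq0 invr_eq0 pnatr_eq0 (negPf b0) /=.
  by rewrite subr_eq0 => /eqP.
by apply: rV4_ext; [exact: subr0_eq|exact: cancel|exact: cancel|exact: cancel].
Qed.

End QuaternionicFrame.

(** * The quaternionic span of a special homothety *)

Section SpecialHomothety.
Context {R : realType} {n : nat} {M : manifold R n}.
Implicit Types (S T : {linear vfield M -> vfield M}) (X Y Z : vfield M).

Lemma almost_complex_inj0 T Y :
  (forall Z, T (T Z) = - Z) -> T Y = 0 -> Y = 0.
Proof. by move=> TT TY; apply: oppr_inj; rewrite -TT TY linear0 oppr0. Qed.

(** As [TX, TX] = 0, the derivative (L_(TX) T) X is - T [TX, X], and T is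
    injective. *)
Lemma lie_frame_central T X :
  (forall Z, T (T Z) = - Z) -> lie_endo (T X) T X = 0 -> lie X (T X) = 0.
Proof.
move=> TT /eqP; rewrite /lie_endo lieYY sub0r oppr_eq0 => /eqP TlX.
by rewrite lieN (almost_complex_inj0 _ _ TT TlX) oppr0.
Qed.

(** (L_(TX) S) X differs from [TX, SX] by S [TX, X], which vanishes when X and
    TX commute. *)
Lemma lie_frame_product S T X Y :
  lie X (T X) = 0 -> lie_endo (T X) S X = Y -> lie (T X) (S X) = Y.
Proof.
by move=> XTX <-; rewrite /lie_endo (lieN _ X) XTX oppr0 linear0 subr0.
Qed.

(** I, J, K make vector fields a module over the quaternions, and a nonzero
    quaternion is invertible, so it cannot annihilate X. *)
Lemma quaternion_span_free (I J K : {linear vfield M -> vfield M}) X :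
  (forall Y, I (I Y) = - Y) -> (forall Y, J (J Y) = - Y) ->
  (forall Y, I (J Y) = K Y) -> (forall Y, J (I Y) = - K Y) ->
  X != 0 -> forall t0 t1 t2 t3,
  real_comb X (I X) (J X) (K X) t0 t1 t2 t3 = 0 ->
  [/\ t0 = 0, t1 = 0, t2 = 0 & t3 = 0].
Proof.
move=> II JJ IJ JI X0 t0 t1 t2 t3 comb0.
have IK Y : I (K Y) = - J Y by rewrite -IJ II.
have KI Y : K (I Y) = J Y by rewrite -IJ JI linearN IK opprK.
have JK Y : J (K Y) = I Y by rewrite -[K Y]opprK -JI linearN JJ opprK.
have KK Y : K (K Y) = - Y by rewrite -[LHS]IJ JK II.
have KJ Y : K (J Y) = - I Y by rewrite -IJ JJ linearN.
set Y := real_comb _ _ _ _ _ _ _ _ in comb0.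
(* The quaternion t0 - t1 i - t2 j - t3 k is the conjugate of the one whose
   action on X is Y, so it takes Y to the multiple of X by the squared norm. *)
have conjY : real_comb Y (I Y) (J Y) (K Y) t0 (- t1) (- t2) (- t3) =
    cstC M (t0 ^+ 2 + t1 ^+ 2 + t2 ^+ 2 + t3 ^+ 2) *: X.
  rewrite /Y !linear_real_comb II JJ KK IJ JI IK KI JK KJ; unfold real_comb.
  apply: vfield_ext => ev [evD evN ev0 evZ].
  by rewrite !(evD, evN, ev0, evZ); ring.
have norm0 : t0 ^+ 2 + t1 ^+ 2 + t2 ^+ 2 + t3 ^+ 2 = 0.
  apply/eqP; apply: contraNT X0 => nt0; apply/eqP.
  apply: (cstC_scale_eq0 _ _ nt0); rewrite -conjY comb0 !linear0.
  by rewrite /real_comb !scaler0 !addr0.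
by split; apply/eqP; rewrite -sqrf_eq0; apply/eqP; nra.
Qed.

(** For X = 0 the homothety condition reads a g = 0, which contradicts the
    existence of an orthonormal basis at some point. *)
Lemma homothety_neq0 r (g : vfield M -> vfield M -> Cinf M) (a : R) X :
  (0 < n)%N -> pseudo_riemannian r g -> a != 0 ->
  (forall Y Z, lie_form X g Y Z = a *: g Y Z) -> X != 0.
Proof.
move=> n0 [glin gsym gsig] a0 hX; apply/eqP => X0.
have g0l Z : g 0 Z = 0.
  by have := glin (-1) 0 0 Z; rewrite scaler0 addr0 mulN1r addNr.
have [x _] := manifold_nonempty M; have [E onE] := gsig x.
pose i := Ordinal n0.
have ag0 : a * g (E i) (E i) x = 0.
  change ((a *: g (E i) (E i) : Cinf M) x = 0).
  by rewrite -hX /lie_form X0 lie0l (gsym (E i) 0) g0l !subr0.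
have := onE i i; rewrite eqxx => gE; move/eqP: ag0.
rewrite mulf_eq0 (negPf a0) gE /=; case: ifP => _; first by rewrite oner_eq0.
by rewrite oppr_eq0 oner_eq0.
Qed.

End SpecialHomothety.

Theorem lemma4p1 (R : realType) (m p q : nat) (M : manifold R (4 * m))
    (g : vfield M -> vfield M -> Cinf M) (I J K : {linear vfield M -> vfield M})
    (X : vfield M) (a b : R) :
  (0 < m)%N -> HKT p q g I J K -> special_homothety g I J K a b X ->
  a != 0 -> b != 0 ->
  generate_local_Hstar_action [:: X; I X; J X; K X].
Proof.
move=> m0 [_ metric_g [II _] [JJ _] [KK _] IJ JI _ _ _ _].
case=> hX _ _ _ LII LJJ LKK LIJ LJK LKI a0 b0.
have XIX := lie_frame_central _ _ II (LII X).
have XJX := lie_frame_central _ _ JJ (LJJ X).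
have XKX := lie_frame_central _ _ KK (LKK X).
apply: (quaternionic_frame_action _ _ _ _ _ b0 XIX XJX XKX).
- exact: lie_frame_product XIX (LIJ X).
- exact: lie_frame_product XJX (LJK X).
- exact: lie_frame_product XKX (LKI X).
- apply: quaternion_span_free => //; apply: homothety_neq0 metric_g a0 hX.
  by rewrite muln_gt0.
Qed.
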